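(* Suppose that: (A) each $f_i$ and each $h_i$ is proper, closed and convex, each $f_i$ is $L_i$-smooth for some $L_i>0$, each $f_i+h_i$ is bounded from below, and the problem $\min_{x\in\mathbb{R}^d}\sum_{i\in\mathcal V}(f_i(x)+h_i(x))$ has a non-empty optimal solution set, with (finite) optimal value $F_{\mathrm{opt}}$. Let $L=\max_{i\in\mathcal V}L_i$. Then there is a constant $C\ge0$, depending only on the functions $f_i,h_i$ and the constants $L_i$ ($i\in\mathcal V$) and not on $\alpha$ or $W$, such that the following holds for every averaging matrix $W$ associated with $\mathcal G$ having the property (B) for every $\alpha>0$ the function $\mathbf{x}\mapsto F(\mathbf{x})+\frac{1}{2\alpha}\mathbf{x}^T(I-\mathbf{W})\mathbf{x}$ has a minimizer over $\mathbb{R}^{nd}$, for every $\alpha>0$, and for every fixed point $\mathbf{x}^\star$ of Prox-DGD (with parameters $\alpha$ and $W$). Write $\beta=\max\{|\lambda_2(W)|,|\lambda_n(W)|\}\in[0,1)$, $\bar x^\star=\frac1n\sum_{i\in\mathcal V}x_i^\star$ and $\bar{\mathbf{x}}^\star=\mathbf{1}_n\otimes\bar x^\star$. 1) If one of the following is true: (i) each $f_i+h_i$ is Lipschitz continuous; (ii) each $\operatorname{dom}h_i=\mathbb{R}^d$ and each $f_i+h_i$ is coercive; then $$\|x_i^\star-\bar x^\star\|\le C\,\frac{\alpha}{1-\beta}\quad\forall i\in\mathcal V.$$ 2) If all the $h_i$ are identical and one of the following holds: (i) each $f_i$ and each $h_i$ is bounded from below; (ii) each $f_i$ is Lipschitz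 continuous; (iii) each $f_i+h_i$ is coercive; then $$\|x_i^\star-\bar x^\star\|\le C\,\frac{\alpha}{1-\beta}\quad\forall i\in\mathcal V\qquad\text{and}\qquad F(\bar{\mathbf{x}}^\star)\le F_{\mathrm{opt}}+C\left(\frac{\alpha}{1-\beta}+\frac{L\alpha^2}{2(1-\beta)^2}\right).$$
   Context: $\mathcal G=(\mathcal V,\mathcal E)$ is an undirected connected graph with vertex set $\mathcal V=\{1,\dots,n\}$, $n\ge 2$; $\mathcal E$ contains no self-loops. For each $i\in\mathcal V$, $f_i:\mathbb{R}^d\to\mathbb{R}$ and $h_i:\mathbb{R}^d\to\mathbb{R}\cup\{+\infty\}$. A differentiable function $f$ is $L$-smooth if $\|\nabla f(y)-\nabla f(x)\|\le L\|y-x\|$ for all $x,y$. A function $g$ is coercive if $g(x)\to+\infty$ as $\|x\|\to+\infty$. For $\mathbf{x}=(x_1^T,\dots,x_n^T)^T\in\mathbb{R}^{nd}$ with $x_i\in\mathbb{R}^d$, put $f(\mathbf{x})=\sum_{i}f_i(x_i)$, $h(\mathbf{x})=\sum_i h_i(x_i)$, $F(\mathbf{x})=f(\mathbf{x})+h(\mathbf{x})$. A matrix $W=(w_{ij})\in\mathbb{R}^{n\times n}$ is an averaging matrix associated with $\mathcal G$ if it is symmetric and doubly stochastic (non-negative, each row and each column sums to 1), and $w_{ij}>0$ if $\{i,j\}\in\mathcal E$ or $i=j$, and $w_{ij}=0$ otherwise. $\mathbf{W}=W\otimes I_d$. $\lambda_i(W)$ denotes the $i$-th largest eigenvalue of $W$.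 $\mathbf{1}_n$ is the all-one vector. $\operatorname{prox}_{g}(x)=\arg\min_y\, g(y)+\frac12\|y-x\|^2$. Prox-DGD with step-size $\alpha>0$ is the iteration $\mathbf{x}^{k+1}=\operatorname{prox}_{\alpha h}(\mathbf{W}\mathbf{x}^k-\alpha\nabla f(\mathbf{x}^k))$; a fixed point is $\mathbf{x}^\star=((x_1^\star)^T,\dots,(x_n^\star)^T)^T$ with $\mathbf{x}^\star=\operatorname{prox}_{\alpha h}(\mathbf{W}\mathbf{x}^\star-\alpha\nabla f(\mathbf{x}^\star))$. *)

(* Defs.v *)
From HB Require Import structures.
From mathcomp Require Import all_boot all_order all_algebra.
From mathcomp Require Import all_classical all_reals all_analysis.
From mathcomp.real_closed Require Import mxtens.

Set Implicit Arguments.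
Unset Strict Implicit.
Unset Printing Implicit Defensive.

Import Order.TTheory GRing.Theory Num.Theory.
Import numFieldNormedType.Exports.

Local Open Scope classical_set_scope.
Local Open Scope ring_scope.

Section ExtendedRealFunctions.
Context {R : realType} {d : nat}.
Implicit Types (g : 'cV[R]_d -> \bar R) (f : 'cV[R]_d -> R) (x y : 'cV[R]_d).

(* The library norm `|x| on matrices is the sup norm; all estimates below use
   the Euclidean norm (the two induce the same topology, so `differentiable`,
   'd and `closed` are unaffected). *)
Definition enorm x : R := Num.sqrt (\sum_(j < d) x j 0 ^+ 2).

Definition dom g : set 'cV[R]_d := [set x | (g x < +oo)%E].

Definition proper_fun g : Prop := (forall x, g x != -oo%E) /\ dom g !=set0.

Definition closed_fun g : Prop :=
  closed [set p : 'cV[R]_d * R | (g p.1 <= p.2%:E)%E].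

(* At the endpoints t = 0, 1 the convention 0 * +oo = 0 makes the inequality
   trivial. *)
Definition convex_fun g : Prop :=
  forall (t : R) x y, 0 <= t -> t <= 1 ->
    (g (t *: x + (1 - t) *: y)%R <= t%:E * g x + (1 - t)%:E * g y)%E.

Definition bounded_from_below g : Prop :=
  exists m : R, forall x, (m%:E <= g x)%E.

Definition coercive g : Prop :=
  forall M : R, exists r : R, forall x, r <= enorm x -> (M%:E <= g x)%E.

(* Lipschitz on the whole space, hence finite everywhere; without the finiteness
   clause `fine` would silently send +oo to 0. *)
Definition lipschitz_fun g : Prop :=
  (forall x, g x \is a fin_num) /\
  exists K : R, forall x y, `|fine (g x) - fine (g y)| <= K * enorm (x - y).

Definition argmin g : set 'cV[R]_d := [set x | forall y, (g x <= g y)%E].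

Definition prox g x : set 'cV[R]_d :=
  argmin (fun y => g y + (2^-1 * enorm (y - x) ^+ 2)%:E)%E.

Definition grad f x : 'cV[R]_d := \col_j 'd f x (delta_mx j 0).

Definition smooth (L : R) f : Prop :=
  (forall x, differentiable f x) /\
  (forall x y, enorm (grad f y - grad f x) <= L * enorm (y - x)).

End ExtendedRealFunctions.

Definition connected_graph (n : nat) (e : rel 'I_n) : Prop :=
  [/\ symmetric e, irreflexive e & forall i j, connect e i j].

Section Spectrum.
Context {R : realType} {n : nat}.
Implicit Type W : 'M[R]_n.

Definition doubly_stochastic W : Prop :=
  [/\ forall i j, 0 <= W i j,
      forall i, \sum_j W i j = 1
    & forall j, \sum_i W i j = 1].

Definition averaging_matrix (e : rel 'I_n) W : Prop :=
  [/\ W^T = W, doubly_stochastic W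
    & forall i j, if e i j || (i == j) then 0 < W i j else W i j == 0].

(* Real eigenvalues with multiplicity, in non-increasing order.  The sequence
   exists and is unique (of size n) when the characteristic polynomial splits
   over R, in particular for symmetric W. *)
Definition eigenvalues_desc W : seq R :=
  xget [::] [set s : seq R | sorted >=%R s /\
                             char_poly W = \prod_(z <- s) ('X - z%:P)].

(* 1-based: lambda W 1 is the largest eigenvalue, lambda W n the smallest. *)
Definition lambda W (i : nat) : R := nth 0 (eigenvalues_desc W) i.-1.

Definition beta W : R := Num.max `|lambda W 2| `|lambda W n|.

End Spectrum.

Section ProxDGD.
Context {R : realType} {n d : nat}.
Implicit Types (f : 'I_n -> 'cV[R]_d -> R) (h : 'I_n -> 'cV[R]_d -> \bar R).
Implicit Types (W : 'M[R]_n) (alpha : R) (x : 'cV[R]_(n * d)).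

(* The block x_i of a stacked vector, in the index convention of the Kronecker
   product *t. *)
Definition block x (i : 'I_n) : 'cV[R]_d := \col_j x (mxtens_index (i, j)) 0.

Definition sep_f f x : R := \sum_(i < n) f i (block x i).
Definition sep_h h x : \bar R := (\sum_(i < n) h i (block x i))%E.
Definition Fobj f h x : \bar R := ((sep_f f x)%:E + sep_h h x)%E.

Definition consensus_obj f h (y : 'cV[R]_d) : \bar R :=
  (\sum_(i < n) ((f i y)%:E + h i y))%E.

Definition Fopt f h : \bar R := ereal_inf (range (consensus_obj f h)).

Definition bigW W : 'M[R]_(n * d) := W *t (1%:M : 'M[R]_d).

Definition penalized_obj f h W alpha x : \bar R :=
  (Fobj f h x
   + ((2 * alpha)^-1 * (x^T *m (1%:M - bigW W) *m x) 0 0)%:E)%E.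

(* prox is set-valued, so x = prox(...) is read as membership in the argmin. *)
Definition prox_dgd_fixed_point f h W alpha x : Prop :=
  prox (fun y => alpha%:E * sep_h h y)%E
       (bigW W *m x - alpha *: grad (sep_f f) x) x.

Definition average x : 'cV[R]_d := n%:R^-1 *: \sum_(i < n) block x i.

Definition stacked_average x : 'cV[R]_(n * d) :=
  (const_mx 1 : 'cV[R]_n) *t average x.

End ProxDGD.

(* Main.v *)
Require Import Defs.
From HB Require Import structures.
From mathcomp Require Import all_boot all_order all_algebra.
From mathcomp Require Import all_classical all_reals all_analysis.
From mathcomp.real_closed Require Import mxtens.
From mathcomp Require Import complex spectral ring lra zify.

(* Write X_i for the blocks of a fixed point and g_i = (1/alpha) (sum_j w_ij X_j
   - X_i).
   The optimality condition of the prox makes g_i - grad f_i(X_i) a subgradient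
   of h_i at X_i, hence g_i a subgradient of f_i + h_i.  Since W is doubly
   stochastic, summing the latter inequalities gives F(X) <= Fopt, so each X_i
   lies in a sublevel set of f_i + h_i that does not depend on alpha or W; there
   either the subgradients of f_i + h_i (case 1) or grad f_i (case 2) are bounded
   by some G.
   On the orthogonal complement of the constants, I - W >= (1 - beta) I, so that
   (1 - beta) sum_i |X_i - Xbar|^2 <= - alpha sum_i <g_i, X_i - Xbar>.  In case 1
   |g_i| <= G and Cauchy-Schwarz concludes.  In case 2 the h_i coincide, and
   summing their subgradient inequalities at Xbar (with Jensen) shows
   sum_i <g_i - grad f_i(X_i), X_i - Xbar> >= 0, so that grad f_i(X_i) can take
   the place of g_i.  The bound on F(Xbar) then follows from Jensen's inequality for
   h and from f_i(Xbar) <= f_i(X_i) - <grad f_i(Xbar), X_i - Xbar>. *)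

Set Implicit Arguments.
Unset Strict Implicit.
Unset Printing Implicit Defensive.

Import Order.TTheory GRing.Theory Num.Theory.
Import numFieldNormedType.Exports.
Local Open Scope classical_set_scope.
Local Open Scope ring_scope.

(** * Spectral gap of averaging matrices *)

(** Expanding the square leaves two diagonal terms, each equal to the squared norm of [u] because
    rows and columns of [A] sum to 1, and two cross terms, each turned by the eigenvalue equation
    into [l] times that norm. The hypotheses on [s] cover both signs at once. *)
Lemma dirichlet_form_eigenvector (C : numClosedFieldType) (n : nat)
    (A : 'M[C]_n) (u : 'I_n -> C) (l s : C) :
  (forall j k, A j k = A k j) -> (forall j, \sum_k A j k = 1) ->
  (forall k, \sum_j u j * A j k = l * u k) -> s^* = s -> s ^+ 2 = 1 ->
  \sum_j \sum_k A j k * `|u j + s * u k| ^+ 2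
  = 2 * (1 + s * l) * \sum_j `|u j| ^+ 2.
Proof.
move=> symA rowA eigu sJ s2.
have colA k : \sum_j A j k = 1.
  by rewrite -(rowA k); apply: eq_bigr => j _; exact: symA.
have cross : \sum_j \sum_k A j k * (u j * (u k)^*) = l * \sum_j `|u j| ^+ 2.
  rewrite exchange_big mulr_sumr; apply: eq_bigr => k _ /=.
  rewrite normCK mulrA -eigu mulr_suml; apply: eq_bigr => j _; ring.
have cross' : \sum_j \sum_k A j k * (u k * (u j)^*) = l * \sum_j `|u j| ^+ 2.
  rewrite -cross exchange_big; apply: eq_bigr => k _; apply: eq_bigr => j _ /=.
  by rewrite symA.
have -> : 2 * (1 + s * l) * \sum_j `|u j| ^+ 2 =
    \sum_j `|u j| ^+ 2 + \sum_j `|u j| ^+ 2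
    + s * (l * \sum_j `|u j| ^+ 2) + s * (l * \sum_j `|u j| ^+ 2) by ring.
rewrite -{1}cross -cross'.
have -> : \sum_j `|u j| ^+ 2 + \sum_j `|u j| ^+ 2 =
    \sum_j \sum_k A j k * `|u j| ^+ 2 + \sum_j \sum_k A j k * `|u k| ^+ 2.
  congr (_ + _); last rewrite exchange_big; apply: eq_bigr => j _ /=.
    by rewrite -mulr_suml rowA mul1r.
  by rewrite -mulr_suml colA mul1r.
rewrite !mulr_sumr -!big_split; apply: eq_bigr => j _ /=.
rewrite !mulr_sumr -!big_split; apply: eq_bigr => k _ /=.
rewrite !normCK rmorphD rmorphM /= sJ.
have -> : A j k * ((u j + s * u k) * ((u j)^* + s * (u k)^*)) =
   A j k * (u j * (u j)^*) + s^+2 * (A j k * (u k * (u k)^*)) +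
   s * (A j k * (u j * (u k)^*)) + s * (A j k * (u k * (u j)^*)) by ring.
by rewrite s2 mul1r; ring.
Qed.

(* The choices s = 1 and s = -1 in the Dirichlet form bound l from below and
   above; for s = -1 and l = 1 it vanishes, so u is constant along edges. *)
Lemma averaging_eigenvalue (R : realType) (n : nat) (e : rel 'I_n) (W : 'M[R]_n)
    (u : 'I_n -> R[i]) (l : R) :
  connected_graph e -> averaging_matrix e W ->
  (exists j, u j != 0) ->
  (forall k, \sum_j u j * (W j k)%:C%C = l%:C%C * u k) ->
  [/\ -1 < l, l <= 1 & l = 1 -> forall j k, u j = u k].
Proof.
move=> [_ _ conn] [symW [W_ge0 rowW _] posW] [j0 uj0] eigu.
pose A := map_mx (real_complex R) W.
have AE j k : A j k = (W j k)%:C%C by rewrite mxE.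
have A_ge0 j k : 0 <= A j k by rewrite AE ler0c.
have symA j k : A j k = A k j by rewrite !AE -{1}symW mxE.
have rowA j : \sum_k A j k = 1.
  under eq_bigr do rewrite AE.
  by rewrite -rmorph_sum rowW.
have eiguA k : \sum_j u j * A j k = l%:C%C * u k.
  by rewrite -eigu; apply: eq_bigr => j _; rewrite AE.
have N_gt0 : 0 < \sum_j `|u j| ^+ 2.
  rewrite (bigD1 j0) //= ltr_pwDl ?exprn_gt0 ?normr_gt0 //.
  by apply: sumr_ge0 => j _; rewrite exprn_ge0.
have term_ge0 s j k : 0 <= A j k * `|u j + s * u k| ^+ 2.
  by rewrite mulr_ge0 ?exprn_ge0.
have dir1 := dirichlet_form_eigenvector symA rowA eiguA
  (rmorph1 Num.conj) (expr1n _ _).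
have dirN := dirichlet_form_eigenvector symA rowA eiguA
  (rmorphN1 Num.conj) (etrans (sqrrN _) (expr1n _ _)).
split.
(* The diagonal entry at [j0] is positive, so the term j = k = [j0], a positive multiple of |2
   u_j0|^2, makes the form strictly positive; this excludes l = -1. *)
- have : 0 < 2 * (1 + 1 * l%:C%C) * \sum_j `|u j| ^+ 2.
    rewrite -dir1 (bigD1 j0) //= (bigD1 j0) //= -addrA ltr_pwDl //.
      rewrite mulr_gt0 ?exprn_gt0 ?normr_gt0 //.
        rewrite AE (_ : 0 = (0 : R)%:C%C) // ltcR.
        by have := posW j0 j0; rewrite eqxx orbT.
      by rewrite mul1r -mulr2n mulrn_eq0.
    by rewrite addr_ge0 ?sumr_ge0 // => j _; rewrite sumr_ge0.
  rewrite pmulr_lgt0 // pmulr_rgt0 // mul1r (_ : 1 = (1 : R)%:C%C) //.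
  rewrite -rmorphD (_ : 0 = (0 : R)%:C%C) // ltcR; lra.
- have : 0 <= 2 * (1 + -1 * l%:C%C) * \sum_j `|u j| ^+ 2.
    by rewrite -dirN; apply: sumr_ge0 => j _; apply: sumr_ge0.
  rewrite pmulr_lge0 // pmulr_rge0 // mulN1r (_ : 1 = (1 : R)%:C%C) //.
  rewrite -rmorphB (_ : 0 = (0 : R)%:C%C) // lecR; lra.
- move=> l1; move: dirN; rewrite l1 (_ : (1 : R)%:C%C = 1) // mulr1 subrr.
  rewrite mulr0 mul0r => dir0.
  have edge j k : e j k -> u j = u k.
    move=> ejk; have := dir0.
    move/(psumr_eq0P (fun j _ => sumr_ge0 _ (fun k _ => term_ge0 (-1) j k))).
    move=> /(_ j erefl).
    move/(psumr_eq0P (fun k _ => term_ge0 (-1) j k)) => /(_ k erefl).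
    move/eqP; rewrite mulf_eq0 expf_eq0 /= normr_eq0 mulN1r subr_eq0.
    case/orP => /eqP // Ajk; have := posW j k; rewrite ejk /=.
    by move: Ajk; rewrite AE => -[->]; rewrite ltxx.
  move=> j k; case/connectP: (conn j k) => p + ->.
  elim: p j => //= i p IHp j /andP[/edge-> /IHp]; exact.
Qed.

Lemma char_poly_similar (F : fieldType) (n : nat) (P B : 'M[F]_n) :
  P \in unitmx -> char_poly (invmx P *m B *m P) = char_poly B.
Proof.
move=> uP; rewrite /char_poly.
have -> : char_poly_mx (invmx P *m B *m P) =
    map_mx polyC (invmx P) *m char_poly_mx B *m map_mx polyC P.
  rewrite /char_poly_mx mulmxBr mulmxBl !map_mxM /=; congr (_ - _).
  by rewrite scalar_mxC -mulmxA -map_mxM mulVmx // map_mx1 mulmx1.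
by rewrite !det_mulmx mulrC mulrA -det_mulmx -map_mxM mulmxV // map_mx1 det1 mul1r.
Qed.

Local Open Scope sesquilinear_scope.

(** A real symmetric matrix is Hermitian over [R[i]], so the complex spectral theorem applies and
    the eigenvalues are real. The last two conjuncts connect these eigenvalues to
    [eigenvalues_desc], by uniqueness of the factorisation of the characteristic polynomial. *)
Lemma symmetric_spectral (R : realType) (n : nat) (W : 'M[R]_n) :
  W^T = W ->
  exists (P : 'M[R[i]]_n) (D : 'I_n -> R),
    [/\ P \is unitarymx,
        map_mx (real_complex R) W
        = P^t* *m diag_mx (\row_i (D i)%:C%C) *m P,
        sorted >=%R (eigenvalues_desc W)
      & perm_eq (eigenvalues_desc W) [seq D i | i <- enum 'I_n]].
Proof.
move=> symW; pose A := map_mx (real_complex R) W.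
have hermA : A \is hermsymmx.
  apply: realsym_hermsym.
    apply/is_hermitianmxP; rewrite expr0 scale1r.
    by apply/matrixP => i j; rewrite !mxE -{1}symW mxE.
  by apply/mxOverP => i j; rewrite mxE complex_real.
pose P := spectralmx A; pose D i := complex.Re (spectral_diag A 0 i).
have uP : P \is unitarymx := spectral_unitarymx A.
have DE : spectral_diag A = \row_i (D i)%:C%C.
  apply/rowP => i; rewrite mxE RRe_real //.
  exact: (mxOverP (hermitian_spectral_diag_real hermA)).
have AE := orthomx_spectralP (hermitian_normalmx hermA).
have charW : char_poly W = \prod_(z <- [seq D i | i <- enum 'I_n]) ('X - z%:P).
  apply: (map_poly_inj (real_complex R)).
  rewrite map_char_poly -/A AE char_poly_similar ?spectral_unit //.
  rewrite char_poly_trig ?diag_mx_is_trig // big_map map_prod_XsubC big_enum /=.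
  by apply: eq_bigr => i _; rewrite mxE eqxx DE mxE.
(* The sorted list of the [D i] shows that the set is inhabited, so [xget] does not return its
   default [[::]]. *)
have [sorted_s char_s] : [set s : seq R | sorted >=%R s /\
    char_poly W = \prod_(z <- s) ('X - z%:P)] (eigenvalues_desc W).
  apply: (@xgetPex _ _ _).
  exists (sort >=%R [seq D i | i <- enum 'I_n]); split.
    by apply: sort_sorted => a b; exact: le_total.
  by rewrite charW; apply: perm_big; rewrite perm_sym perm_sort.
exists P, D; split => //.
  by rewrite -DE -invmx_unitary.
by apply: prod_XsubC_eq; rewrite -char_s.
Qed.

(* In an orthonormal eigenbasis, the only eigenvector for the eigenvalue 1 is
   constant, so a vector y with zero sum only has components on eigenvalues
   at most lambda_2. *)
Lemma averaging_spectral_gap (R : realType) (n : nat) (e : rel 'I_n)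
    (W : 'M[R]_n) :
  (2 <= n)%N -> connected_graph e -> averaging_matrix e W ->
  0 <= beta W < 1 /\
  forall y : 'I_n -> R, \sum_i y i = 0 ->
    (1 - beta W) * \sum_i y i ^+ 2 <= \sum_i y i * (y i - \sum_j W i j * y j).
Proof.
move=> n_ge2 conn avg; have [symW [_ rowW _] _] := avg.
have [P [D [uP AE sorted_s perm_s]]] := symmetric_spectral symW.
set A := map_mx _ W in AE.
have PtP : P^t* *m P = 1%:M.
  by rewrite -invmx_unitary // mulVmx // unitarymx_unit.
have PPt := unitarymxP uP.
have eigP i k : \sum_j P i j * (W j k)%:C%C = (D i)%:C%C * P i k.
  have : (P *m A) i k = (diag_mx (\row_i (D i)%:C%C) *m P) i k.
    by rewrite AE !mulmxA PPt mul1mx.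
  rewrite mul_diag_mx !mxE => <-.
  by apply: eq_bigr => j _; rewrite mxE.
have P_neq0 i : exists j, P i j != 0.
  apply/existsP; apply: contraT => /existsPn P0.
  have := congr1 (fun M : 'M[R[i]]_n => M i i) PPt.
  rewrite !mxE eqxx big1 => [/esym/eqP|j _]; first by rewrite oner_eq0.
  by have /negbNE/eqP -> := P0 j; rewrite mul0r.
have DP i : [/\ -1 < D i, D i <= 1 & D i = 1 -> forall j k, P i j = P i k].
  exact: (averaging_eigenvalue conn avg (P_neq0 i) (eigP i)).
pose one : 'cV[R[i]]_n := const_mx 1.
have Aone : A *m one = one.
  apply/colP => j; rewrite !mxE.
  under eq_bigr do rewrite !mxE mulr1.
  by rewrite -rmorph_sum rowW.
(* Since W fixes the constant vector, the latter has components only along eigenvectors for the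
   eigenvalue 1; as [P] is invertible, at least one component is non-zero. *)
have Done i : (P *m one) i 0 != 0 -> D i = 1.
  move=> Pi0; have : (P *m (A *m one)) i 0 = (D i)%:C%C * (P *m one) i 0.
    rewrite mulmxA AE !mulmxA PPt mul1mx -mulmxA mul_diag_mx !mxE.
    by [].
  rewrite Aone -[LHS]mul1r => /(mulIf Pi0)/esym.
  by rewrite (_ : 1 = (1 : R)%:C%C) // => -[].
have [i0 Pi0] : exists i, (P *m one) i 0 != 0.
  apply/existsP; apply: contraT => /existsPn P0.
  have : P^t* *m (P *m one) = 0.
    rewrite (_ : P *m one = 0) ?mulmx0 //; apply/colP => i.
    by rewrite [RHS]mxE; exact/eqP/negbNE/P0.
  rewrite mulmxA PtP mul1mx => /colP/(_ (Ordinal (ltnW n_ge2)))/eqP.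
  by rewrite !mxE oner_eq0.
have Di0 := Done _ Pi0.
(* Two distinct rows for the eigenvalue 1 would both be constant and non-zero, hence not
   orthogonal. *)
have D1 i : D i = 1 -> i = i0.
  move=> Di; apply/eqP; apply: contraT => ii0.
  have [j Pij] := P_neq0 i; have [j' Pij'] := P_neq0 i0.
  have := congr1 (fun M : 'M[R[i]]_n => M i i0) PPt.
  rewrite !mxE (negbTE ii0) => /eqP.
  under eq_bigr => k _.
    rewrite !mxE; have [_ _ /(_ Di) /(_ k j) ->] := DP i.
    have [_ _ /(_ Di0) /(_ k j') ->] := DP i0; over.
  rewrite sumr_const card_ord -mulr_natr mulf_eq0 pnatr_eq0 mulf_eq0 conjC_eq0.
  by rewrite (negbTE Pij) (negbTE Pij') /=; case: (n) n_ge2.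
have s_DP l : l \in eigenvalues_desc W -> exists i, l = D i.
  by rewrite (perm_mem perm_s) => /mapP[i _ ->]; exists i.
have D_s i : D i \in eigenvalues_desc W.
  by rewrite (perm_mem perm_s) map_f // mem_enum.
have count1 : count_mem 1 (eigenvalues_desc W) = 1%N.
  rewrite (permP perm_s) count_map (_ : 1%N = (i0 \in enum 'I_n)); last first.
    by rewrite mem_enum.
  rewrite -count_uniq_mem ?enum_uniq //; apply: eq_count => i /=.
  by apply/eqP/eqP => [/D1|->].
have size_s : size (eigenvalues_desc W) = n.
  by rewrite (perm_size perm_s) size_map size_enum_ord.
(* The head of the sorted list is the simple eigenvalue 1. As n >= 2, both [lambda W 2] and
   [lambda W n] lie in the tail, whose entries are in (-1, 1). *)
have [l2_lt1 ln_lt1 Dl2] : [/\ `|lambda W 2| < 1, `|lambda W n| < 1 &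
    forall i, i != i0 -> D i <= lambda W 2].
  rewrite /lambda /=.
  case: (eigenvalues_desc W) sorted_s size_s s_DP D_s count1 => [|a [|b s]] /=.
  - by move=> _ n0; exfalso; clear -n0 n_ge2; lia.
  - by move=> _ n1; exfalso; clear -n1 n_ge2; lia.
  move=> /andP[ba ps] size_s s_DP D_s count1.
  have a1 : a = 1.
    apply/eqP; rewrite eq_le; apply/andP; split.
      by have [|i ->] := s_DP a; [rewrite inE eqxx | case: (DP i)].
    have := D_s i0; rewrite Di0 !inE => /or3P[/eqP -> //|/eqP -> //|s1].
    have /allP/(_ _ s1) := order_path_min (rev_trans le_trans) ps.
    by move=> /le_trans; apply.
  have bs l : l \in b :: s -> l <= b.
    rewrite inE => /predU1P[-> //|ls].
    by have /allP/(_ _ ls) := order_path_min (rev_trans le_trans) ps.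
  have b_lt1 : b < 1.
    rewrite lt_neqAle -{2}a1 ba andbT; apply/eqP => b1.
    by move: count1; rewrite a1 b1 !eqxx.
  have norm_lt1 l : l \in b :: s -> `|l| < 1.
    move=> ls; rewrite ltr_norml (le_lt_trans (bs _ ls)) // andbT.
    by have [|i ->] := s_DP l; [rewrite inE ls orbT | case: (DP i)].
  split; first by rewrite norm_lt1 // mem_head.
    apply: norm_lt1; rewrite -size_s /=.
    by apply: (@mem_nth _ 0 (b :: s)).
  move=> i ii0; apply: bs; have := D_s i; rewrite inE => /predU1P[Dia|//].
  by move: ii0; rewrite (D1 i) ?eqxx // Dia.
split.
  by rewrite /beta le_max normr_ge0 gt_max l2_lt1 ln_lt1.
move=> y sum_y.
pose yc : 'cV[R[i]]_n := \col_i (y i)%:C%C.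
pose c := P *m yc.
have ytE : yc^t* = yc^T.
  by apply/matrixP => i j; rewrite !mxE; exact: conjc_real.
(* The row [i0] of [P] is constant and [y] sums to zero. In the remaining coordinates the claim
   reduces to D i <= beta W, by Parseval. *)
have ci0 : c i0 0 = 0.
  rewrite mxE; have [_ _ /(_ Di0) Pconst] := DP i0.
  under eq_bigr => k _ do rewrite (Pconst k i0) mxE.
  by rewrite -mulr_sumr -rmorph_sum sum_y mulr0.
have normE : (\sum_i y i ^+ 2)%:C%C = \sum_i `|c i 0| ^+ 2.
  have : (yc^t* *m yc) 0 0 = (c^t* *m c) 0 0.
    by rewrite /c trmx_mul map_mxM -mulmxA (mulmxA _ P) PtP mul1mx.
  rewrite ytE !mxE rmorph_sum => H; apply: (etrans _ (etrans H _)).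
    by apply: eq_bigr => i _; rewrite !mxE -rmorphM.
  by apply: eq_bigr => i _; rewrite normCK !mxE mulrC.
have quadE : (\sum_i y i * \sum_j W i j * y j)%:C%C =
    \sum_i (D i)%:C%C * `|c i 0| ^+ 2.
  have : (yc^t* *m (A *m yc)) 0 0 =
      (c^t* *m (diag_mx (\row_i (D i)%:C%C) *m c)) 0 0.
    by rewrite AE /c trmx_mul map_mxM !mulmxA.
  rewrite ytE !mxE rmorph_sum => H; apply: (etrans _ (etrans H _)).
    apply: eq_bigr => i _; rewrite !mxE rmorphM rmorph_sum; congr (_ * _).
    by apply: eq_bigr => j _; rewrite !mxE rmorphM.
  apply: eq_bigr => i _; rewrite mul_diag_mx normCK !mxE; ring.
have -> : \sum_i y i * (y i - \sum_j W i j * y j) =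
    \sum_i y i ^+ 2 - \sum_i y i * \sum_j W i j * y j.
  by rewrite -sumrB; apply: eq_bigr => i _; rewrite mulrBr expr2.
rewrite -lecR rmorphM [X in _ <= X]rmorphB /= quadE normE mulr_sumr -sumrB.
apply: ler_sum => i _.
have -> : `|c i 0| ^+ 2 - (D i)%:C%C * `|c i 0| ^+ 2 =
    (1 - D i)%:C%C * `|c i 0| ^+ 2.
  by rewrite [in RHS]rmorphB mulrBl mul1r.
have [->|ii0] := eqVneq i i0; first by rewrite ci0 normr0 expr0n !mulr0.
apply: ler_wpM2r; first by rewrite exprn_ge0.
rewrite lecR lerD2l lerN2 (le_trans (Dl2 i ii0)) // /beta le_max.
by rewrite ler_norm.
Qed.
Local Close Scope sesquilinear_scope.

(** * Euclidean geometry and subgradients *)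

Section EuclideanSpace.
Context {R : realType} {d : nat}.
Implicit Types (x y z p : 'cV[R]_d) (a : R).

Definition dot x y : R := \sum_j x j 0 * y j 0.

Lemma dotC x y : dot x y = dot y x.
Proof. by apply: eq_bigr => j _; rewrite mulrC. Qed.

Lemma dotDl x y z : dot (x + y) z = dot x z + dot y z.
Proof. by rewrite -big_split; apply: eq_bigr => j _; rewrite !mxE mulrDl. Qed.

Lemma dotZl a x y : dot (a *: x) y = a * dot x y.
Proof. by rewrite mulr_sumr; apply: eq_bigr => j _; rewrite !mxE mulrA. Qed.

Lemma dotDr x y z : dot x (y + z) = dot x y + dot x z.
Proof. by rewrite !(dotC x) dotDl. Qed.

Lemma dotZr a x y : dot x (a *: y) = a * dot x y.
Proof. by rewrite !(dotC x) dotZl. Qed.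

Lemma dotNl x y : dot (- x) y = - dot x y.
Proof. by rewrite -scaleN1r dotZl mulN1r. Qed.

Lemma dotNr x y : dot x (- y) = - dot x y.
Proof. by rewrite !(dotC x) dotNl. Qed.

Lemma dot0l y : dot 0 y = 0.
Proof. by apply: big1 => j _; rewrite mxE mul0r. Qed.

Lemma dot_suml (I : finType) (F : I -> 'cV[R]_d) y :
  dot (\sum_i F i) y = \sum_i dot (F i) y.
Proof.
by elim/big_ind2: _ => [|u v u' v' <- <-|//]; rewrite ?dot0l ?dotDl.
Qed.

Lemma dot_ge0 x : 0 <= dot x x.
Proof. by apply: sumr_ge0 => j _; rewrite -expr2 sqr_ge0. Qed.

Lemma enorm_ge0 x : 0 <= enorm x.
Proof. exact: sqrtr_ge0. Qed.

Lemma enorm_sqr x : enorm x ^+ 2 = dot x x.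
Proof.
by rewrite sqr_sqrtr ?sumr_ge0 // => j _; rewrite sqr_ge0.
Qed.

Lemma enorm_coord x j : `|x j 0| <= enorm x.
Proof.
rewrite -(@ler_pXn2r _ 2) ?nnegrE ?enorm_ge0 // enorm_sqr /dot (bigD1 j) //=.
rewrite real_normK ?num_real // expr2 lerDl sumr_ge0 // => i _.
by rewrite -expr2 sqr_ge0.
Qed.

Lemma enorm_eq0 x : enorm x = 0 -> x = 0.
Proof.
move=> x0; apply/colP => j; apply/eqP; rewrite mxE -normr_le0 -x0.
exact: enorm_coord.
Qed.

Lemma enormZ a x : enorm (a *: x) = `|a| * enorm x.
Proof.
apply/eqP; rewrite -(@eqrXn2 _ 2) ?mulr_ge0 ?enorm_ge0 //.
by rewrite exprMn !enorm_sqr dotZl dotZr real_normK ?num_real // mulrA expr2.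
Qed.

Lemma enormN x : enorm (- x) = enorm x.
Proof. by rewrite -scaleN1r enormZ normrN1 mul1r. Qed.

Lemma enormB x y : enorm (x - y) = enorm (y - x).
Proof. by rewrite -enormN opprB. Qed.

(** Cauchy-Schwarz, from the non-negativity of the squared norm of |y|^2 x - <x, y> y. *)
Lemma dot_le x y : dot x y <= enorm x * enorm y.
Proof.
have [y0|y0] := eqVneq (enorm y) 0.
  by rewrite y0 (enorm_eq0 y0) dotC dot0l mulr0.
have y_gt0 : 0 < enorm y ^+ 2 by rewrite exprn_gt0 // lt_def y0 enorm_ge0.
apply: (le_trans (ler_norm _)).
rewrite -(@ler_pXn2r _ 2) ?nnegrE ?mulr_ge0 ?enorm_ge0 //.
rewrite exprMn real_normK ?num_real //.
have := dot_ge0 (enorm y ^+ 2 *: x - dot x y *: y).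
rewrite !(dotDl, dotDr, dotNl, dotNr, dotZl, dotZr) (dotC y x) -!enorm_sqr.
rewrite [X in 0 <= X -> _](_ : _ =
  enorm y ^+ 2 * (enorm x ^+ 2 * enorm y ^+ 2 - dot x y ^+ 2)); last by ring.
by rewrite pmulr_rge0 // subr_ge0.
Qed.

Lemma dot_ge x y : - (enorm x * enorm y) <= dot x y.
Proof. by rewrite lerNl -dotNl -(enormN x) dot_le. Qed.

Lemma ler_enormD x y : enorm (x + y) <= enorm x + enorm y.
Proof.
rewrite -(@ler_pXn2r _ 2) ?nnegrE ?addr_ge0 ?enorm_ge0 //.
rewrite enorm_sqr !(dotDl, dotDr) (dotC y x) -!enorm_sqr.
have := dot_le x y; lra.
Qed.

End EuclideanSpace.

(** * Subgradients, proximal points and gradients of convex functions *)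

Section Subgradients.
Context {R : realType} {d : nat}.
Implicit Types (g h : 'cV[R]_d -> \bar R) (f : 'cV[R]_d -> R).
Implicit Types (x y z p q v : 'cV[R]_d).

Definition subgradient g x p : Prop :=
  forall z, (g x + (dot p (z - x)%R)%:E <= g z)%E.

Lemma subgradientD g h x p q :
  subgradient g x p -> subgradient h x q ->
  subgradient (fun z => g z + h z)%E x (p + q).
Proof.
by move=> gp hq z; rewrite dotDl EFinD addeACA leeD.
Qed.

Lemma convex_le g (t a b : R) x y :
  convex_fun g -> 0 <= t -> t <= 1 -> (g x <= a%:E)%E -> (g y <= b%:E)%E ->
  (g (t *: x + (1 - t) *: y)%R <= (t * a + (1 - t) * b)%:E)%E.
Proof.
move=> cvx t0 t1 xa yb; apply: (le_trans (cvx t x y t0 t1)).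
by rewrite [leRHS]EFinD !EFinM leeD // lee_wpmul2l // lee_fin // subr_ge0.
Qed.

(** Induction: the mean of k + 2 points combines the mean of the first k + 1 with the last point,
    with weight [t] = (k + 1) / (k + 2). Real upper bounds [r] avoid sums of infinite values. *)
Lemma jensen g (k : nat) (y : 'I_k.+1 -> 'cV[R]_d) (r : 'I_k.+1 -> R) :
  convex_fun g -> (forall i, g (y i) <= (r i)%:E)%E ->
  (g (k.+1%:R^-1 *: \sum_i y i)%R <= (k.+1%:R^-1 * \sum_i r i)%:E)%E.
Proof.
move=> cvx; elim: k y r => [|k IHk] y r le_gy.
  by rewrite !big_ord1 invr1 scale1r mul1r.
pose t : R := k.+1%:R / k.+2%:R.
have t0 : 0 <= t by rewrite divr_ge0 ?ler0n.
have t1 : t <= 1 by rewrite ler_pdivrMr ?ltr0n // mul1r ler_nat.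
have tE : t * k.+1%:R^-1 = k.+2%:R^-1.
  by rewrite /t mulrAC mulfV ?mul1r ?pnatr_eq0.
have t'E : 1 - t = k.+2%:R^-1.
  rewrite /t -{1}[1](@mulfV _ k.+2%:R) ?pnatr_eq0 //.
  by rewrite -mulrBl -natrB // subSnn mul1r.
rewrite [\sum_i y i]big_ord_recr [\sum_i r i]big_ord_recr /= scalerDr mulrDr.
rewrite -[in X in X *: _ + _]tE -scalerA.
rewrite -[in X in X * _ + _]tE -mulrA -t'E.
apply: convex_le => //.
by apply: (IHk (fun i => y (widen_ord (leqnSn k.+1) i))
               (fun i => r (widen_ord (leqnSn k.+1) i))).
Qed.

Lemma ler0_of_small (a b : R) :
  (forall t, 0 < t -> t <= 1 -> a <= t * b) -> a <= 0.
Proof.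
move=> ab; rewrite leNgt; apply/negP => a0.
have := ab 1 ltr01 (lexx _); rewrite mul1r => ab1.
have b0 : 0 < b by exact: lt_le_trans ab1.
(* This choice of t would give a <= a / 2; it is at most 1 because a <= b. *)
have := ab (a / (2 * b)) _ _.
rewrite (_ : a / (2 * b) * b = a / 2); last by field; exact: lt0r_neq0.
by rewrite divr_gt0 ?mulr_gt0 // ler_pdivrMr ?mulr_gt0 //; lra.
Qed.

(** Minimality of x is tested at x + t (z - x). Convexity makes the variation of [g] linear in t,
    the quadratic term contributes an extra t^2, and dividing by t and letting t tend to 0 leaves
    the first-order inequality. *)
Lemma prox_subgradient g (alpha : R) x v :
  0 < alpha -> convex_fun g -> (forall z, g z != -oo%E) -> (g x < +oo)%E ->
  prox (fun y => alpha%:E * g y)%E v x ->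
  subgradient g x (alpha^-1 *: (v - x)).
Proof.
move=> alpha0 cvx g_neqNy gx_lty xmin z.
case gz : (g z) (g_neqNy z) => [b| |] // _; last by rewrite leey.
case gx : (g x) (g_neqNy x) gx_lty => [a| |] // _ _.
rewrite -EFinD lee_fin dotZl.
suff : dot (v - x) (z - x) - alpha * (b - a) <= 0.
  rewrite subr_le0 mulrC -ler_pdivrMr // [_ / _]mulrC; lra.
apply: (@ler0_of_small _ (2^-1 * enorm (z - x) ^+ 2)) => t t0 t1.
have gw : (g (t *: z + (1 - t) *: x)%R <= (t * b + (1 - t) * a)%:E)%E.
  by apply: convex_le; rewrite ?gz ?gx // ltW.
have := xmin (t *: z + (1 - t) *: x); rewrite gx => xle.
have : ((alpha * a + 2^-1 * enorm (x - v) ^+ 2)%:E <=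
   (alpha * (t * b + (1 - t) * a)
    + 2^-1 * enorm (t *: z + (1 - t) *: x - v) ^+ 2)%:E)%E.
  rewrite EFinD EFinM; apply: (le_trans xle).
  rewrite [leRHS]EFinD [in leRHS]EFinM; apply: leeD => //.
  by apply: lee_wpmul2l => //; rewrite lee_fin ltW.
rewrite lee_fin.
have -> : t *: z + (1 - t) *: x - v = (x - v) + t *: (z - x).
  by apply/matrixP => i j; rewrite !mxE; ring.
rewrite !enorm_sqr !(dotDl (x - v)) !(dotDr (_ - _) (x - v)) !(dotDr _ (x - v)).
rewrite !dotZl !dotZr (dotC (z - x) (x - v)) => H.
have Hv : dot (v - x) (z - x) = - dot (x - v) (z - x).
  by rewrite -dotNl opprB.
rewrite Hv -(ler_pM2l t0); lra.
Qed.

Lemma dot_grad f x v : differentiable f x -> dot (grad f x) v = 'd f x v.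
Proof.
move=> df; rewrite [in RHS](matrix_sum_delta v).
under eq_bigr do rewrite big_ord1.
rewrite linear_sum; apply: eq_bigr => j _.
by rewrite mxE linearZ /= mulrC.
Qed.

(** By convexity the difference quotients at x towards z are at most f z - f x for 0 < t <= 1; their
    right limit is the directional derivative. *)
Lemma convex_grad f x :
  convex_fun (EFin \o f) -> differentiable f x ->
  subgradient (EFin \o f) x (grad f x).
Proof.
move=> cvx df z; rewrite /= -EFinD lee_fin dot_grad // -deriveE //.
rewrite -lerBrDl.
have : derivable f x (z - x) by exact: diff_derivable.
move=> /(cvg_dnbhs_at_right) H.
rewrite /derive -(cvg_lim (@Rhausdorff R) H).
apply: limr_le; first by apply/cvg_ex; eexists; exact: H.
near=> t.
have t0 : 0 < t by near: t; exact: nbhs_right_gt.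
have t1 : t <= 1 by near: t; exact: nbhs_right_le.
have := @convex_le _ t (f z) (f x) z x cvx (ltW t0) t1 (lexx _) (lexx _).
rewrite lee_fin /= => fle.
rewrite -[_ *: _]/(_ * _) mulrC ler_pdivrMr //.
have -> : t *: (z - x) + x = t *: z + (1 - t) *: x.
  by rewrite scalerBl scale1r scalerBr addrAC addrA.
lra.
Unshelve. all: by end_near. Qed.

(** A unit step along p raises [g] by at least |p|, so any bound on that increase bounds p. *)
Lemma subgradient_enorm_le g x p (K : R) :
  subgradient g x p -> g x \is a fin_num ->
  (g (x + (enorm p)^-1 *: p)%R <= (fine (g x) + K)%:E)%E -> 0 <= K ->
  enorm p <= K.
Proof.
move=> gp gx gle K0; have [-> //|p0] := eqVneq (enorm p) 0.
have := le_trans (gp _) gle.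
rewrite -{1}(fineK gx) -EFinD lee_fin lerD2l addrC addKr dotZr -enorm_sqr.
by rewrite expr2 mulKf.
Qed.

Lemma enorm_normalize p : enorm ((enorm p)^-1 *: p) <= 1.
Proof.
rewrite enormZ ger0_norm ?invr_ge0 ?enorm_ge0 //.
have [->|p0] := eqVneq (enorm p) 0; first by rewrite mulr0.
by rewrite mulVf.
Qed.

Lemma lipschitz_subgradient g :
  lipschitz_fun g ->
  exists2 K, 0 <= K & forall x p, subgradient g x p -> enorm p <= K.
Proof.
move=> [gfin [K lipK]]; exists `|K| => // x p gp.
apply: subgradient_enorm_le gp (gfin x) _ _ => //.
rewrite -(fineK (gfin _)) lee_fin -lerBlDl (le_trans (ler_norm _)) //.
rewrite (le_trans (lipK _ _)) // addrC addKr.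
rewrite (le_trans (ler_wpM2r (enorm_ge0 _) (ler_norm K))) //.
by rewrite -{2}[`|K|]mulr1 ler_wpM2l // enorm_normalize.
Qed.

Lemma convex_bounded_above_segment g (s : R) v :
  convex_fun g -> (forall x, g x \is a fin_num) -> 0 < s ->
  exists M : R, forall t, `|t| <= s -> (g (t *: v)%R <= M%:E)%E.
Proof.
move=> cvx gfin s0.
pose M := Num.max (fine (g (s *: v))) (fine (g (- s *: v))).
exists M => t; rewrite ler_norml => /andP[st ts].
(* The weight for which t = u s + (1 - u) (- s). *)
pose u := (t + s) / (2 * s).
have -> : t *: v = u *: (s *: v) + (1 - u) *: (- s *: v).
  rewrite !scalerA -scalerDl; congr (_ *: _); rewrite /u; field.
  exact: lt0r_neq0.
rewrite (_ : M = u * M + (1 - u) * M); last by ring.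
apply: convex_le => //.
- by apply: divr_ge0; lra.
- by rewrite ler_pdivrMr ?mulr_gt0 //; lra.
- by rewrite -[leLHS]fineK // lee_fin le_max lexx.
- by rewrite -[leLHS]fineK // lee_fin le_max lexx orbT.
Qed.

End Subgradients.

(* x is the mean of the points (d x_j) e_j, each lying on a coordinate segment. *)
Lemma convex_bounded_above_ball (R : realType) (d : nat) (g : 'cV[R]_d -> \bar R)
    (r : R) :
  convex_fun g -> (forall x, g x \is a fin_num) ->
  exists M : R, forall x, enorm x <= r -> (g x <= M%:E)%E.
Proof.
case: d g => [|k] g cvx gfin.
  exists (fine (g 0)) => x _; rewrite fineK // (_ : x = 0) //.
  by apply/colP => -[].
pose s : R := k.+1%:R * (`|r| + 1).
have s0 : 0 < s by rewrite mulr_gt0 ?ltr0n ?ltr_wpDl.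
pose c := fun j : 'I_k.+1 => sval (cid (convex_bounded_above_segment
  (delta_mx j 0) cvx gfin s0)).
have cP j t : `|t| <= s -> (g (t *: delta_mx j 0)%R <= (c j)%:E)%E.
  by rewrite /c; case: cid => M /=; apply.
exists (k.+1%:R^-1 * \sum_j c j) => x xr.
have -> : x = k.+1%:R^-1 *: \sum_j (k.+1%:R * x j 0) *: delta_mx j 0.
  under eq_bigr do rewrite -scalerA.
  rewrite -scaler_sumr scalerA mulVf ?pnatr_eq0 // scale1r.
  rewrite [LHS]matrix_sum_delta; apply: eq_bigr => j _; exact: big_ord1.
apply: jensen => // j; apply: cP; rewrite normrM ger0_norm ?ler0n //.
rewrite ler_wpM2l // (le_trans (enorm_coord _ _)) // (le_trans xr) //.
by rewrite (le_trans (ler_norm r)) // lerDl.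
Qed.

(** A unit step from the ball of radius [r] stays in that of radius [r + 1], where [g] is bounded
    above; so the increase of [g] is at most [M - m]. *)
Lemma subgradient_bounded_ball (R : realType) (d : nat) (g : 'cV[R]_d -> \bar R)
    (r : R) :
  convex_fun g -> (forall x, g x \is a fin_num) -> bounded_from_below g ->
  exists2 K : R, 0 <= K &
    forall x p, enorm x <= r -> subgradient g x p -> enorm p <= K.
Proof.
move=> cvx gfin [m gm].
have [M gM] := convex_bounded_above_ball (r + 1) cvx gfin.
exists `|M - m| => // x p xr gp.
apply: subgradient_enorm_le gp (gfin x) _ _ => //.
have := gm x; rewrite -(fineK (gfin x)) lee_fin => mx.
apply: (le_trans (gM _ _)).
  by rewrite (le_trans (ler_enormD _ _)) // lerD // enorm_normalize.
rewrite lee_fin; have := ler_norm (M - m); lra.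
Qed.

(* Gradient step of size 1/(2L): convexity at the new point replaces the descent
   lemma, at the price of the constant 4 instead of 2. *)
Lemma smooth_convex_grad_sqr_le (R : realType) (d : nat) (f : 'cV[R]_d -> R)
    (L m : R) x :
  0 < L -> smooth L f -> convex_fun (EFin \o f) -> (forall y, m <= f y) ->
  enorm (grad f x) ^+ 2 <= 4 * L * (f x - m).
Proof.
move=> L0 [df lipf] cvx fm.
pose q := grad f x; pose t := (2 * L)^-1; pose y := x - t *: q.
have t0 : 0 < t by rewrite invr_gt0 mulr_gt0.
have := convex_grad cvx (df y) x.
rewrite /= -EFinD lee_fin.
have -> : x - y = t *: q by rewrite /y opprB addrC subrK.
rewrite dotZr => fy.
(* As L t = 1/2, the gradient at y stays within |q| / 2 of q, so its product with q is at least
   |q|^2 / 2. *)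
have : enorm (grad f y - q) <= L * (t * enorm q).
  have := lipf x y; rewrite -/q (_ : y - x = - t *: q).
    by rewrite enormZ normrN ger0_norm // ltW.
  by rewrite /y addrC addKr scaleNr.
move=> /(ler_wpM2r (enorm_ge0 q)) qy.
have := fm y; move: (grad f y) (f y) fy qy => w fy_val fy qy fmy.
have := dot_ge (w - q) q; rewrite dotDl dotNl -(enorm_sqr q).
have tL : L * t = 2^-1 by rewrite /t; field; exact: lt0r_neq0.
move: qy; rewrite mulrA tL => qy qy'.
have tq : t * (2^-1 * enorm q ^+ 2) <= t * dot w q.
  rewrite ler_wpM2l ?(ltW t0) //; lra.
rewrite -/q; have -> : enorm q ^+ 2 = 4 * L * (t * (2^-1 * enorm q ^+ 2)).
  rewrite [RHS](_ : _ = 4 * (L * t) * (2^-1 * enorm q ^+ 2)); last by ring.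
  by rewrite tL; field.
rewrite ler_pM2l ?mulr_gt0 //; lra.
Qed.

(** * Block vectors and Prox-DGD fixed points *)

Section Blocks.
Context {R : realType} {n d : nat}.
Implicit Types (x v : 'cV[R]_(n * d)) (i : 'I_n) (z : 'I_n -> 'cV[R]_d).
Implicit Types (f : 'I_n -> 'cV[R]_d -> R) (h : 'I_n -> 'cV[R]_d -> \bar R).

Lemma sum_mxtens (V : nmodType) (F : 'I_(n * d) -> V) :
  \sum_k F k = \sum_i \sum_j F (mxtens_index (i, j)).
Proof.
rewrite pair_big /= (reindex (@mxtens_index n d)) /=.
  by apply: eq_bigr => -[].
exists (@mxtens_unindex n d) => k _; first exact: mxtens_indexK.
exact: mxtens_unindexK.
Qed.

Definition stack z : 'cV[R]_(n * d) :=
  \col_k z (mxtens_unindex k).1 (mxtens_unindex k).2 0.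

Lemma block_stack z i : block (stack z) i = z i.
Proof. by apply/colP => j; rewrite !mxE mxtens_indexK. Qed.

Lemma block_stacked_average x i : block (stacked_average x) i = average x.
Proof. by apply/colP => j; rewrite !mxE mxtens_indexK mul1r !ord1. Qed.

(** The arguments of [block] are swapped so that the partial application carries a linear structure,
    needed to differentiate compositions with it. *)
Definition block_at i x : 'cV[R]_d := block x i.

Fact block_at_is_linear i : linear (block_at i).
Proof. by move=> a x y; apply/colP => j; rewrite !mxE. Qed.

HB.instance Definition _ i :=
  GRing.isLinear.Build R 'cV[R]_(n * d) 'cV[R]_d _ (block_at i)
    (block_at_is_linear i).

Lemma blockB x v i : block (x - v) i = block x i - block v i.
Proof. exact: (linearB (block_at i)). Qed.

Lemma continuous_block_at i : continuous (block_at i).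
Proof.
move=> x s /= /nbhs_ballP [e e0 es]; apply/nbhs_ballP; exists e => //= y [_ xy].
by apply: es; split => // j k; rewrite !mxE; exact: xy.
Qed.

Lemma block_bigW (W : 'M[R]_n) x i :
  block (bigW W *m x) i = \sum_j W i j *: block x j.
Proof.
apply/colP => j; rewrite !mxE sum_mxtens summxE; apply: eq_bigr => k _.
rewrite (bigD1 j) //= tensmxE mxE eqxx mulr1 big1 ?addr0 => [|l lj].
  by rewrite !mxE.
by rewrite tensmxE mxE eq_sym (negbTE lj) mulr0 mul0r.
Qed.

Lemma dot_block x y : dot x y = \sum_i dot (block x i) (block y i).
Proof.
rewrite /dot sum_mxtens; apply: eq_bigr => i _; apply: eq_bigr => j _.
by rewrite !mxE.
Qed.

Lemma enorm_blockB x v :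
  enorm (x - v) ^+ 2 = \sum_i enorm (block x i - block v i) ^+ 2.
Proof.
by rewrite enorm_sqr dot_block; apply: eq_bigr => i _; rewrite blockB -enorm_sqr.
Qed.

(** Chain rule for each [f k \o block_at k]: the coordinate direction (i, j) has zero k-th block
    unless k = i. *)
Lemma block_grad_sep f x i :
  (forall k y, differentiable (f k) y) ->
  block (grad (sep_f f) x) i = grad (f i) (block x i).
Proof.
move=> df; apply/colP => j; rewrite !mxE.
have dblock k : differentiable (block_at k) x.
  exact/linear_differentiable/continuous_block_at.
have dcomp k : differentiable (f k \o block_at k) x.
  exact: differentiable_comp.
have sepE : sep_f f = \sum_(k < n) (f k \o block_at k).
  by apply/funext => y; rewrite fct_sumE.
rewrite sepE -deriveE; last exact: differentiable_sum.
rewrite derive_sum => [|k]; last exact: diff_derivable.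
have dE k v : 'D_v (f k \o block_at k) x = 'd (f k) (block x k) (block v k).
  rewrite deriveE // diff_comp //= diff_lin //; exact: continuous_block_at.
rewrite (bigD1 i) //= dE big1 ?addr0 => [|k ki]; last first.
  rewrite dE (_ : block (delta_mx _ _) k = 0) ?linear0 //; apply/colP => l.
  rewrite !mxE andbT; case: eqP => // /(congr1 (@mxtens_unindex n d)).
  by rewrite !mxtens_indexK => -[ik]; rewrite ik eqxx in ki.
congr ('d _ _ _); apply/colP => l; rewrite !mxE !andbT.
congr (nat_of_bool _)%:R.
apply/eqP/eqP => [/(congr1 (@mxtens_unindex n d))|->//].
by rewrite !mxtens_indexK => -[].
Qed.

Lemma prox_sep h (alpha : R) v x :
  0 < alpha -> (forall i, proper_fun (h i)) ->
  prox (fun y => alpha%:E * sep_h h y)%E v x ->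
  (forall i, h i (block x i) \is a fin_num) /\
  forall i, prox (fun y => alpha%:E * h i y)%E (block v i) (block x i).
Proof.
move=> alpha0 proper_h xmin.
have h_neqNy i y : h i y != -oo%E by have [] := proper_h i.
(* Points chosen in the domains of the [h i] form a competitor of finite value, so the value at the
   minimizer x is below +oo. *)
have sep_lty : (sep_h h x < +oo)%E.
  have z0 i : {y | (h i y < +oo)%E} 
    by apply/cid; have [_ [y hy]] := proper_h i; exists y.
  have := xmin (stack (fun i => sval (z0 i))) => xle.
  have : (alpha%:E * sep_h h x + (2^-1 * enorm (x - v) ^+ 2)%:E < +oo)%E.
    apply: (le_lt_trans xle); rewrite lte_add_pinfty ?ltry //.
    rewrite lte_mul_pinfty ?lee_fin ?(ltW alpha0) //.
    by apply: lte_sum_pinfty => i _; rewrite block_stack; case: (z0 i).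
  case: (sep_h h x) => [a _| |_]; rewrite ?ltry ?ltNyr //.
  by rewrite gt0_muley ?lte_fin // addye.
have fin i : h i (block x i) \is a fin_num.
  rewrite fin_numE h_neqNy /=; apply/eqP => hi; move: sep_lty.
  rewrite /sep_h (_ : (\sum_(i < n) _)%E = +oo%E) // esum_eqyP //.
  by exists i; split; rewrite ?mem_index_enum.
split=> // i y; have := h_neqNy i y.
case hy : (h i y) => [b| |] // _; last first.
  by rewrite gt0_muley ?lte_fin // addye // leey.
(* The competitor differs from x in block i only, so all other terms cancel. *)
pose z k := if k == i then y else block x k.
pose a k := fine (h k (block x k)); pose a' k := if k == i then b else a k.
have hz k : h k (z k) = (a' k)%:E.
  by rewrite /z /a' /a; case: eqP => [->//|_]; rewrite fineK.
have := xmin (stack z).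
have -> : sep_h h x = (\sum_k a k)%:E.
  by rewrite -sumEFin; apply: eq_bigr => k _; rewrite fineK.
have -> : sep_h h (stack z) = (\sum_k a' k)%:E.
  by rewrite -sumEFin; apply: eq_bigr => k _; rewrite block_stack hz.
have -> : enorm (stack z - v) ^+ 2 = \sum_k enorm (z k - block v k) ^+ 2.
  by rewrite enorm_blockB; apply: eq_bigr => k _; rewrite block_stack.
rewrite enorm_blockB -(fineK (fin i)) -!EFinM -!EFinD !lee_fin -/(a i).
rewrite !(bigD1 (P := predT) i) //= /a' /z eqxx.
rewrite [X in _ <= _ * (_ + X) + _ -> _](eq_bigr a) => [|k /negbTE -> //].
rewrite [X in _ <= _ + _ * (_ + X) -> _]
  (eq_bigr (fun k => enorm (block x k - block v k) ^+ 2)) => [|k /negbTE -> //].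
lra.
Qed.

End Blocks.

(** * Distance to the centroid, from the spectral gap *)

Section Consensus.
Context {R : realType} {n d : nat}.
Implicit Types (e : rel 'I_n) (W : 'M[R]_n) (X p : 'I_n -> 'cV[R]_d).

Definition centroid X : 'cV[R]_d := n%:R^-1 *: \sum_i X i.

(** This is the vector g_i of the overview. *)
Definition pull W (alpha : R) X i : 'cV[R]_d :=
  alpha^-1 *: (\sum_j W i j *: X j - X i).

Lemma sum_centroid X : (2 <= n)%N -> \sum_i (X i - centroid X) = 0.
Proof.
move=> n_ge2; rewrite sumrB sumr_const card_ord -scaler_nat /centroid scalerA.
by rewrite mulfV ?scale1r ?subrr // pnatr_eq0; lia.
Qed.

(** The scalar spectral gap is applied to each coordinate of the deviations [E i], which sum to
    zero; subtracting the centroid does not change X - W X because rows of W sum to 1. *)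
Lemma consensus_gap e W X :
  (2 <= n)%N -> connected_graph e -> averaging_matrix e W ->
  (1 - beta W) * \sum_i enorm (X i - centroid X) ^+ 2
  <= \sum_i dot (X i - \sum_j W i j *: X j) (X i - centroid X).
Proof.
move=> n_ge2 conn avg; have [_ [_ rowW _] _] := avg.
have [_ gap] := averaging_spectral_gap n_ge2 conn avg.
pose E i := X i - centroid X.
have WE i : X i - \sum_j W i j *: X j = E i - \sum_j W i j *: E j.
  rewrite /E; under [in RHS]eq_bigr do rewrite scalerBr.
  by rewrite sumrB -scaler_suml rowW scale1r opprB addrA subrK.
under eq_bigr do rewrite enorm_sqr.
rewrite [leRHS](_ : _ = \sum_k \sum_i E i k 0 * (E i k 0 - \sum_j W i j * E j k 0)).
  rewrite exchange_big /= mulr_sumr; apply: ler_sum => k _.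
  under eq_bigr do rewrite -expr2.
  apply: gap; have := congr1 (fun u : 'cV[R]_d => u k 0) (sum_centroid X n_ge2).
  by rewrite summxE mxE.
rewrite exchange_big; apply: eq_bigr => k _; apply: eq_bigr => i _.
rewrite WE mulrC -/(E i); clearbody E; rewrite !mxE summxE.
by congr (_ * (_ - _)); apply: eq_bigr => j _; rewrite !mxE.
Qed.

Lemma sum_pull_const W alpha X (z : 'cV[R]_d) :
  doubly_stochastic W -> \sum_i dot (pull W alpha X i) z = 0.
Proof.
move=> [_ _ colW]; rewrite -dot_suml /pull -scaler_sumr sumrB exchange_big /=.
rewrite [X in X - _](eq_bigr X) ?subrr ?scaler0 ?dot0l // => j _.
by rewrite -scaler_suml colW scale1r.
Qed.

Lemma sum_pull_centroid_le0 e W alpha X :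
  (2 <= n)%N -> connected_graph e -> averaging_matrix e W -> 0 < alpha ->
  (1 - beta W) * \sum_i enorm (X i - centroid X) ^+ 2
  <= - (alpha * \sum_i dot (pull W alpha X i) (X i - centroid X)).
Proof.
move=> n_ge2 conn avg alpha0.
apply: (le_trans (consensus_gap X n_ge2 conn avg)).
rewrite mulr_sumr -sumrN; apply: ler_sum => i _.
by rewrite /pull dotZl mulVKf ?gt_eqF // -dotNl opprB.
Qed.

(** The last hypothesis allows [p] to replace [pull] in the gap inequality. With S the norm of all
    deviations together, this gives (1 - beta) S^2 <= alpha n G S, and one factor S cancels. In case
    1 [p] is [pull] itself; in case 2 it is the gradient of the f_i. *)
Lemma consensus_error e W alpha X p (G : R) :
  (2 <= n)%N -> connected_graph e -> averaging_matrix e W -> 0 < alpha ->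
  0 <= G -> (forall i, enorm (p i) <= G) ->
  0 <= \sum_i dot (pull W alpha X i - p i) (X i - centroid X) ->
  forall i, enorm (X i - centroid X) <= n%:R * G * (alpha / (1 - beta W)).
Proof.
move=> n_ge2 conn avg alpha0 G0 pG mono.
have [/andP[_ beta1] _] := averaging_spectral_gap n_ge2 conn avg.
pose S := Num.sqrt (\sum_i enorm (X i - centroid X) ^+ 2).
have S2 : S ^+ 2 = \sum_i enorm (X i - centroid X) ^+ 2.
  by rewrite sqr_sqrtr // sumr_ge0 // => i _; rewrite sqr_ge0.
have ES i : enorm (X i - centroid X) <= S.
  rewrite -(@ler_pXn2r _ 2) ?nnegrE ?enorm_ge0 ?sqrtr_ge0 // S2 (bigD1 i) //=.
  by rewrite lerDl sumr_ge0 // => j _; rewrite sqr_ge0.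
have S0 : 0 <= S := sqrtr_ge0 _.
move=> i; apply: (le_trans (ES i)).
have sum_p : - \sum_i dot (p i) (X i - centroid X) <= n%:R * G * S.
  rewrite -sumrN [leRHS](_ : _ = \sum_(i < n) G * S); last first.
    by rewrite sumr_const card_ord -mulrA mulr_natl.
  apply: ler_sum => j _; rewrite lerNl (le_trans _ (dot_ge _ _)) // lerN2.
  by rewrite ler_pM ?enorm_ge0.
have main : (1 - beta W) * S ^+ 2 <= alpha * (n%:R * G * S).
  rewrite S2 (le_trans (sum_pull_centroid_le0 X n_ge2 conn avg alpha0)) //.
  rewrite -mulrN ler_pM2l // (le_trans _ sum_p) // lerN2 -subr_ge0 -sumrB.
  by under eq_bigr do rewrite -dotNl -dotDl.
have [S_eq0|S_neq0] := eqVneq S 0.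
  by rewrite S_eq0 !mulr_ge0 ?ler0n ?invr_ge0 ?subr_ge0 // ltW.
have S_gt0 : 0 < S by rewrite lt_def S_neq0.
rewrite mulrA ler_pdivlMr ?subr_gt0 // -(ler_pM2r S_gt0).
rewrite [leLHS](_ : _ = (1 - beta W) * S ^+ 2); last by ring.
by rewrite [leRHS](_ : _ = alpha * (n%:R * G * S)); last by ring.
Qed.

End Consensus.

(** * Bounds on sublevel sets, independent of alpha and W *)

Section UniformBounds.
Context {R : realType} {d : nat}.
Implicit Types (f : 'cV[R]_d -> R) (h : 'cV[R]_d -> \bar R).

Lemma convex_funD f h :
  convex_fun (EFin \o f) -> convex_fun h ->
  convex_fun (fun x => (f x)%:E + h x)%E.
Proof.
move=> cvxf cvxh t x y t0 t1.
apply: (le_trans (leeD (cvxf t x y t0 t1) (cvxh t x y t0 t1))).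
by rewrite !muleDr ?fin_num_adde_defr // addeACA.
Qed.

End UniformBounds.

Section SublevelBounds.
Context {R : realType} {d : nat}.
Variables (f : 'cV[R]_d -> R) (h : 'cV[R]_d -> \bar R).
Hypothesis cvx_f : convex_fun (EFin \o f).
Let phi := (fun y => (f y)%:E + h y)%E.

Lemma coercive_sublevel (c : R) :
  coercive phi -> exists r, forall y, (phi y <= c%:E)%E -> enorm y <= r.
Proof.
move=> /(_ (c + 1))[r rP]; exists r => y yc; rewrite leNgt; apply/negP => ry.
have := le_trans (rP y (ltW ry)) yc; rewrite lee_fin; lra.
Qed.

Lemma subgradient_bounded_sublevel (c : R) :
  proper_fun h -> convex_fun h -> bounded_from_below phi ->
  lipschitz_fun phi \/ dom h = [set: 'cV[R]_d] /\ coercive phi ->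
  exists2 K : R, 0 <= K &
    forall y p, (phi y <= c%:E)%E -> subgradient phi y p -> enorm p <= K.
Proof.
move=> [h_neqNy _] cvx_h phi_bdd [lip|[dom_h coer]].
  by have [K K0 KP] := lipschitz_subgradient lip; exists K => // y p _ /KP.
have [r rP] := coercive_sublevel c coer.
have phi_fin y : phi y \is a fin_num.
  rewrite fin_numD /= fin_numE h_neqNy /= -ltey.
  by have : dom h y by rewrite dom_h.
have [K K0 KP] := subgradient_bounded_ball r (convex_funD cvx_f cvx_h) phi_fin
  phi_bdd.
by exists K => // y p /rP; exact: KP.
Qed.

(** In the first case a lower bound of [h] bounds [f] above on the sublevel set, and |grad f|^2 is
    at most a multiple of f minus its lower bound. In the second, gradients are subgradients of a
    Lipschitz function. In the third, the sublevel set lies in a ball, where smoothness compares the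
    gradient with its value at 0. *)
Lemma grad_bounded_sublevel (L c : R) :
  0 < L -> smooth L f ->
  [\/ bounded_from_below (EFin \o f) /\ bounded_from_below h,
      lipschitz_fun (EFin \o f) | coercive phi] ->
  exists2 K : R, 0 <= K &
    forall y, (phi y <= c%:E)%E -> enorm (grad f y) <= K.
Proof.
move=> L0 smooth_f; have [df lip_grad] := smooth_f.
case=> [[[m fm] [m' hm]]|lip|coer].
- exists (Num.sqrt (4 * L * (c - m' - m))) => // y yc.
  have fm' z : m <= f z by have := fm z; rewrite lee_fin.
  have := le_trans (leeD2l _ (hm y)) yc; rewrite -EFinD lee_fin => fyc.
  have := smooth_convex_grad_sqr_le y L0 smooth_f cvx_f fm'.
  have LK : 4 * L * (f y - m) <= 4 * L * (c - m' - m).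
    by rewrite ler_pM2l ?mulr_gt0 //; lra.
  move=> /le_trans/(_ LK) gradK.
  rewrite -(@ler_pXn2r _ 2) ?nnegrE ?enorm_ge0 ?sqrtr_ge0 // [leRHS]sqr_sqrtr //.
  exact: le_trans (sqr_ge0 _) gradK.
- have [K K0 KP] := lipschitz_subgradient lip; exists K => // y _.
  exact/KP/convex_grad.
- have [r rP] := coercive_sublevel c coer.
  exists (L * `|r| + enorm (grad f 0)) => [|y /rP yr].
    by rewrite addr_ge0 ?enorm_ge0 // mulr_ge0 // ltW.
  rewrite -(subrK (grad f 0) (grad f y)) (le_trans (ler_enormD _ _)) // lerD2r.
  rewrite (le_trans (lip_grad _ _)) // subr0 ler_pM2l // (le_trans yr) //.
  exact: ler_norm.
Qed.

End SublevelBounds.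

Lemma uniform_bound (R : realType) (n : nat) (Q : 'I_n -> R -> Prop) :
  (forall i K K', K <= K' -> Q i K -> Q i K') ->
  (forall i, exists2 K, 0 <= K & Q i K) ->
  exists2 K, 0 <= K & forall i, Q i K.
Proof.
move=> mono ex.
have /choice[K KP] i : exists K, 0 <= K /\ Q i K.
  by have [K K0 QK] := ex i; exists K.
(* The sum of the non-negative bounds dominates each of them. *)
exists (\sum_i K i) => [|i]; first by apply: sumr_ge0 => i _; case: (KP i).
apply: (mono _ (K i)); last by case: (KP i).
by rewrite (bigD1 i) //= lerDl sumr_ge0 // => j _; case: (KP j).
Qed.

(** * First-order conditions and objective value at fixed points *)

Lemma fixed_point_subgradient (R : realType) (n d : nat)
    (f : 'I_n -> 'cV[R]_d -> R) (h : 'I_n -> 'cV[R]_d -> \bar R)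
    (W : 'M[R]_n) (alpha : R) (x : 'cV[R]_(n * d)) :
  0 < alpha -> (forall i y, differentiable (f i) y) ->
  (forall i, proper_fun (h i)) -> (forall i, convex_fun (h i)) ->
  prox_dgd_fixed_point f h W alpha x ->
  forall i, h i (block x i) \is a fin_num /\
    subgradient (h i) (block x i)
      (pull W alpha (block x) i - grad (f i) (block x i)).
Proof.
move=> alpha0 df proper_h cvx_h /(prox_sep alpha0 proper_h)[h_fin xmin] i.
split=> //; have [h_neqNy _] := proper_h i.
rewrite (_ : pull _ _ _ _ - _ = alpha^-1 *:
    (block (bigW W *m x - alpha *: grad (sep_f f) x) i - block x i)).
  by apply: prox_subgradient => //; rewrite ltey_eq h_fin.
rewrite blockB block_bigW (_ : block (_ *: _) i = alpha *: grad (f i) (block x i)).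
  rewrite /pull addrAC [in RHS]scalerBr scalerA mulVf ?scale1r // gt_eqF //.
by rewrite -block_grad_sep //; apply/colP => j; rewrite !mxE.
Qed.

(** Summing the subgradient inequalities at a common z leaves the sum of <g_i, z - X_i>. Since the
    g_i add up to 0, z can be replaced by the centroid, and the spectral gap makes the sum
    non-negative. *)
Lemma fixed_point_value_le (R : realType) (n d : nat)
    (f : 'I_n -> 'cV[R]_d -> R) (h : 'I_n -> 'cV[R]_d -> \bar R)
    (e : rel 'I_n) (W : 'M[R]_n) (alpha : R) (X : 'I_n -> 'cV[R]_d) :
  (2 <= n)%N -> connected_graph e -> averaging_matrix e W -> 0 < alpha ->
  (forall i, subgradient (fun y => (f i y)%:E + h i y)%E (X i)
    (pull W alpha X i)) ->
  (\sum_(i < n) ((f i (X i))%:E + h i (X i)) <= Fopt f h)%E.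
Proof.
move=> n_ge2 conn avg alpha0 sub; apply: le_ereal_inf_tmp => _ [z _ <-].
apply: (@le_trans _ _ (\sum_(i < n) ((f i (X i))%:E + h i (X i)
    + (dot (pull W alpha X i) (z - X i)%R)%:E))%E); last first.
  by apply: lee_sum => i _; exact: sub.
rewrite [leRHS]big_split /= leeDl // sumEFin lee_fin.
have [/andP[_ beta1] _] := averaging_spectral_gap n_ge2 conn avg.
have := sum_pull_centroid_le0 X n_ge2 conn avg alpha0.
have S0 : 0 <= (1 - beta W) * \sum_i enorm (X i - centroid X) ^+ 2.
  rewrite mulr_ge0 ?subr_ge0 ?(ltW beta1) // sumr_ge0 // => i _.
  by rewrite exprn_ge0 ?enorm_ge0.
move=> /(le_trans S0); rewrite oppr_ge0 pmulr_rle0 // => sum_le0.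
have [_ ds _] := avg.
have -> : \sum_i dot (pull W alpha X i) (z - X i) =
    \sum_i dot (pull W alpha X i) (z - centroid X)
    - \sum_i dot (pull W alpha X i) (X i - centroid X).
  rewrite -sumrB; apply: eq_bigr => i _.
  by rewrite -dotNr -dotDr opprB addrA subrK.
by rewrite sum_pull_const // sub0r oppr_ge0.
Qed.

Section Centroid.
Context {R : realType} {n d : nat}.
Variables (h : 'cV[R]_d -> \bar R) (X : 'I_n -> 'cV[R]_d).
Hypotheses (n_gt0 : (0 < n)%N) (cvx_h : convex_fun h).
Hypothesis h_fin : forall i, h (X i) \is a fin_num.

Lemma convex_centroid_le :
  (h (centroid X) <= (n%:R^-1 * \sum_i fine (h (X i)))%:E)%E.
Proof.
case: n X n_gt0 h_fin => // k Y _ fin.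
by apply: jensen => // i; rewrite fineK.
Qed.

(** Each product is at least h(X_i) minus the mean of these values, by Jensen at the centroid; such
    differences sum to zero. *)
Lemma subgradient_centroid_ge0 (q : 'I_n -> 'cV[R]_d) :
  (forall i, subgradient h (X i) (q i)) ->
  0 <= \sum_i dot (q i) (X i - centroid X).
Proof.
move=> sub; pose m := n%:R^-1 * \sum_i fine (h (X i)).
have qm i : fine (h (X i)) - m <= dot (q i) (X i - centroid X).
  have := le_trans (sub i (centroid X)) convex_centroid_le.
  rewrite -{1}(fineK (h_fin i)) -EFinD lee_fin -(opprB (X i)) dotNr -/m.
  by lra.
apply: le_trans (ler_sum _ (fun i _ => qm i)).
rewrite sumrB sumr_const card_ord -mulr_natl /m mulVKf ?subrr //.
by rewrite pnatr_eq0 -lt0n.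
Qed.

End Centroid.

Lemma stacked_average_value_le (R : realType) (n d : nat)
    (f : 'I_n -> 'cV[R]_d -> R) (h : 'I_n -> 'cV[R]_d -> \bar R)
    (L D G : R) (x : 'cV[R]_(n * d)) :
  (0 < n)%N ->
  (forall i, convex_fun (EFin \o f i)) -> (forall i, convex_fun (h i)) ->
  (forall i j, h i = h j) -> (forall i, smooth L (f i)) -> 0 <= L ->
  (forall i, h i (block x i) \is a fin_num) ->
  (forall i, enorm (grad (f i) (block x i)) <= G) ->
  (forall i, enorm (block x i - average x) <= D) ->
  (Fobj f h (stacked_average x)
   <= \sum_(i < n) ((f i (block x i))%:E + h i (block x i))
      + (n%:R * (G * D + L * D ^+ 2))%:E)%E.
Proof.
move=> n_gt0 cvx_f cvx_h h_eq smooth_f L0 h_fin gradG errD.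
pose a i := fine (h i (block x i)).
have h_le i : (h i (average x) <= (n%:R^-1 * \sum_j a j)%:E)%E.
  have := @convex_centroid_le _ _ _ (h i) (block x) n_gt0 (cvx_h i).
  rewrite -/(average x) /a; under [in X in _ -> X]eq_bigr do rewrite (h_eq _ i).
  by apply => j; rewrite (h_eq i j).
have f_le i : f i (average x) <= f i (block x i) + (G * D + L * D ^+ 2).
  have [df lip_grad] := smooth_f i; set E := block x i - average x.
  have := convex_grad (cvx_f i) (df (average x)) (block x i).
  rewrite /= -EFinD lee_fin -/E => fE.
  have := dot_ge (grad (f i) (average x)) E.
  (* The gradient bound [G] is known at the block only; smoothness carries it to the average, and
     the product with D yields G D + L D^2. *)
  have gradA : enorm (grad (f i) (average x)) <= L * D + G.
    rewrite -(subrK (grad (f i) (block x i)) (grad (f i) (average x))).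
    rewrite (le_trans (ler_enormD _ _)) // lerD // (le_trans (lip_grad _ _)) //.
    by rewrite enormB ler_wpM2l // errD.
  have := ler_pM (enorm_ge0 _) (enorm_ge0 _) gradA (errD i); rewrite -/E.
  lra.
have a_sum : (\sum_(i < n) ((f i (block x i))%:E + h i (block x i)))%E =
    (\sum_i f i (block x i) + \sum_i a i)%:E.
  rewrite EFinD -!sumEFin -big_split; apply: eq_bigr => i _ /=.
  by rewrite /a fineK.
rewrite a_sum -EFinD /Fobj addrAC EFinD; apply: leeD.
  rewrite lee_fin /sep_f (_ : n%:R * _ = \sum_(i < n) (G * D + L * D ^+ 2)).
    rewrite -big_split /=.
    by apply: ler_sum => i _; rewrite block_stacked_average; exact: f_le.
  by rewrite sumr_const card_ord mulr_natl.
apply: (@le_trans _ _ (\sum_(i < n) (n%:R^-1 * \sum_j a j)%:E)%E).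
  by apply: lee_sum => i _; rewrite block_stacked_average; exact: h_le.
rewrite sumEFin lee_fin sumr_const card_ord -[leLHS]mulr_natl mulVKf //.
by rewrite pnatr_eq0 -lt0n.
Qed.

(** * Choice of the constant and the two cases *)

Theorem lemma2 (R : realType) (n d : nat) (hn : (2 <= n)%N)
    (f : 'I_n -> 'cV[R]_d -> R) (h : 'I_n -> 'cV[R]_d -> \bar R)
    (Ls : 'I_n -> R)
    (* (A) *)
    (f_pcc : forall i, [/\ proper_fun (EFin \o f i), closed_fun (EFin \o f i)
                         & convex_fun (EFin \o f i)])
    (h_pcc : forall i, [/\ proper_fun (h i), closed_fun (h i)
                         & convex_fun (h i)])
    (Ls_gt0 : forall i, 0 < Ls i)
    (f_smooth : forall i, smooth (Ls i) (f i))
    (fh_bdd : forall i, bounded_from_below (fun x => (f i x)%:E + h i x)%E)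
    (opt_neq0 : argmin (consensus_obj f h) !=set0)
    (Fopt_fin : Fopt f h \is a fin_num) :
  let L := \big[Num.max/0]_(i < n) Ls i in
  exists2 C : R, 0 <= C &
  forall (e : rel 'I_n) (W : 'M[R]_n),
    connected_graph e -> averaging_matrix e W ->
    (* (B) *)
    (forall alpha : R, 0 < alpha ->
       argmin (penalized_obj f h W alpha) !=set0) ->
  forall (alpha : R) (x : 'cV[R]_(n * d)),
    0 < alpha -> prox_dgd_fixed_point f h W alpha x ->
  [/\ 0 <= beta W < 1,
      (* 1) *)
      (forall i, lipschitz_fun (fun y => (f i y)%:E + h i y)%E) \/
      (forall i, dom (h i) = [set: 'cV[R]_d] /\
                 coercive (fun y => (f i y)%:E + h i y)%E) ->
      forall i, enorm (block x i - average x) <= C * (alpha / (1 - beta W))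
    & (* 2) *)
      (forall i j, h i = h j) ->
      [\/ (forall i, bounded_from_below (EFin \o f i) /\
                     bounded_from_below (h i)),
          (forall i, lipschitz_fun (EFin \o f i))
        | (forall i, coercive (fun y => (f i y)%:E + h i y)%E)] ->
      (forall i, enorm (block x i - average x) <= C * (alpha / (1 - beta W))) /\
      (Fobj f h (stacked_average x) <=
         Fopt f h + (C * (alpha / (1 - beta W)
                          + L * alpha ^+ 2 / (2 * (1 - beta W) ^+ 2)))%:E)%E].
Proof.
move=> L.
have df i y : differentiable (f i) y by case: (f_smooth i).
have cvx_f i : convex_fun (EFin \o f i) by case: (f_pcc i).
have cvx_h i : convex_fun (h i) by case: (h_pcc i).
have proper_h i : proper_fun (h i) by case: (h_pcc i).
have n_gt0 : (0 < n)%N := ltnW hn.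
pose phi i := (fun y => (f i y)%:E + h i y)%E.
have Ls_le i : Ls i <= L by exact: (le_bigmax_cond 0 Ls).
have L0 : 0 <= L := le_trans (ltW (Ls_gt0 _)) (Ls_le (Ordinal n_gt0)).
have smooth_L i : smooth L (f i).
  split=> // y z; have [_ lip] := f_smooth i; apply: (le_trans (lip y z)).
  by rewrite ler_wpM2r ?enorm_ge0.
have [m phi_ge] := choice fh_bdd.
(* The optimal value minus the lower bounds of the other phi_j: as the values at a fixed point sum
   to at most [Fopt], phi_i is at most [c i] there. *)
pose c i := m i + (fine (Fopt f h) - \sum_j m j).
pose H1 := (forall i, lipschitz_fun (phi i)) \/
  (forall i, dom (h i) = [set: 'cV[R]_d] /\ coercive (phi i)).
(* The constant is fixed before it is known which hypothesis holds, so excluded middle provides a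
   bound, 0 if [H1] fails; likewise for [H2] below. *)
have [G1 G1_ge0 G1P] : exists2 G, 0 <= G & H1 -> forall i y p,
    (phi i y <= (c i)%:E)%E -> subgradient (phi i) y p -> enorm p <= G.
  have [hyp|nhyp] := pselect H1; last by exists 0.
  have [|i|G G0 GP] := @uniform_bound _ n (fun i G => forall y p,
    (phi i y <= (c i)%:E)%E -> subgradient (phi i) y p -> enorm p <= G).
  - by move=> i K K' KK' KP y p yc yp; exact: le_trans (KP _ _ yc yp) KK'.
  - apply: subgradient_bounded_sublevel => //.
    by case: hyp => /(_ i); [left | right].
  - by exists G.
pose H2 := [\/ (forall i, bounded_from_below (EFin \o f i) /\
                     bounded_from_below (h i)),
          (forall i, lipschitz_fun (EFin \o f i))
        | (forall i, coercive (phi i))].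
have [G2 G2_ge0 G2P] : exists2 G, 0 <= G & H2 -> forall i y,
    (phi i y <= (c i)%:E)%E -> enorm (grad (f i) y) <= G.
  have [hyp|nhyp] := pselect H2; last by exists 0.
  have [|i|G G0 GP] := @uniform_bound _ n (fun i G => forall y,
    (phi i y <= (c i)%:E)%E -> enorm (grad (f i) y) <= G).
  - by move=> i K K' KK' KP y yc; exact: le_trans (KP _ yc) KK'.
  - apply: (@grad_bounded_sublevel _ _ (f i) (h i) (cvx_f i) (Ls i)) => //.
    by case: hyp => /(_ i); [constructor 1 | constructor 2 | constructor 3].
  - by exists G.
pose G := G1 + G2; have G_ge0 : 0 <= G by rewrite addr_ge0.
pose N : R := n%:R; have N_ge1 : 1 <= N by rewrite ler1n.
have N_ge0 : 0 <= N := le_trans ler01 N_ge1.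
(* The first term serves the consensus errors. In the objective estimate, with D = N G2 t, the
   second absorbs N G2 D and N L D^2; its factor 2 compensates the 1/2 in L t^2 / 2. *)
pose C := N * G + 2 * N * (N * G) ^+ 2.
have NGC : N * G <= C by rewrite lerDl !mulr_ge0 // sqr_ge0.
exists C => [|e W conn avg _ alpha x alpha0 fix_x].
  exact: le_trans (mulr_ge0 N_ge0 G_ge0) NGC.
have [beta01 _] := averaging_spectral_gap hn conn avg.
have [_ beta1] := andP beta01.
pose t := alpha / (1 - beta W).
have t_ge0 : 0 <= t by rewrite divr_ge0 ?subr_ge0 ?ltW.
have fixP := fixed_point_subgradient alpha0 df proper_h cvx_h fix_x.
have h_fin i : h i (block x i) \is a fin_num by case: (fixP i).
have h_sub i : subgradient (h i) (block x i)
  (pull W alpha (block x) i - grad (f i) (block x i)) by case: (fixP i).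
have phi_sub i : subgradient (phi i) (block x i) (pull W alpha (block x) i).
  (* Adding the gradient of f_i to the subgradient of h_i gives back [pull]. *)
  rewrite -[pull _ _ _ _](subrKC (grad (f i) (block x i))).
  by apply: subgradientD (h_sub i); exact: convex_grad.
have value_le := fixed_point_value_le hn conn avg alpha0 phi_sub.
have phi_le i : (phi i (block x i) <= (c i)%:E)%E.
  have phi_fin j : phi j (block x j) \is a fin_num by rewrite fin_numD h_fin.
  have : \sum_j fine (phi j (block x j)) <= fine (Fopt f h).
    rewrite -lee_fin fineK // -sumEFin (le_trans _ value_le) //.
    by apply: lee_sum => j _; rewrite fineK.
  rewrite -(fineK (phi_fin i)) lee_fin /c (bigD1 i) //= (bigD1 (P := predT) i) //=.
  have : \sum_(j | j != i) m j <= \sum_(j | j != i) fine (phi j (block x j)).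
    apply: ler_sum => j _; have := phi_ge j (block x j).
    by rewrite -/(phi j _) -{1}(fineK (phi_fin j)) lee_fin.
  lra.
have widen K : 0 <= K -> K <= G -> N * K * t <= C * t.
  move=> K0 KG; rewrite ler_wpM2r // (le_trans _ NGC) // ler_wpM2l //.
have G1G : G1 <= G by rewrite lerDl.
have G2G : G2 <= G by rewrite lerDr.
split=> //.
- move=> hyp i; apply: le_trans (widen G1 G1_ge0 G1G).
  apply: (consensus_error (p := pull W alpha (block x)) hn conn avg alpha0) => //.
    by move=> j; apply: (G1P hyp j (block x j)).
  by apply: sumr_ge0 => j _; rewrite subrr dot0l.
move=> h_eq hyp.
have gradG i : enorm (grad (f i) (block x i)) <= G2 by exact: G2P.
have err i : enorm (block x i - average x) <= N * G2 * t.
  apply: (consensus_error (p := fun j => grad (f j) (block x j)) hn conn avg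
    alpha0) => //.
  (* Any index will do as representative of the common function h. *)
  pose i0 := Ordinal n_gt0.
  apply: (subgradient_centroid_ge0 (h := h i0)) => // j.
    by rewrite (h_eq i0 j).
  by rewrite (h_eq i0 j); exact: h_sub.
split=> [i|]; first exact: le_trans (err i) (widen G2 G2_ge0 G2G).
apply: (le_trans (stacked_average_value_le n_gt0 cvx_f cvx_h h_eq smooth_L L0
  h_fin gradG err)).
apply: leeD => //; rewrite lee_fin -/N.
have -> : L * alpha ^+ 2 / (2 * (1 - beta W) ^+ 2) = L * t ^+ 2 / 2.
  rewrite /t; field; rewrite subr_eq0 gt_eqF //.
have NG2 : N * G2 <= N * G by rewrite ler_wpM2l.
have NG2_sqr : (N * G2) ^+ 2 <= (N * G) ^+ 2.
  by rewrite ler_pXn2r ?nnegrE ?mulr_ge0.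
have linear_part : N * (G2 * (N * G2 * t)) <= C * t.
  rewrite (_ : _ * _ = (N * G2) ^+ 2 * t); last by ring.
  rewrite ler_wpM2r // (le_trans NG2_sqr) //.
  have : 1 * (N * G) ^+ 2 <= N * (N * G) ^+ 2 by rewrite ler_wpM2r ?sqr_ge0.
  have := mulr_ge0 N_ge0 G_ge0; have := sqr_ge0 (N * G); rewrite /C; nra.
have quadratic_part : N * (L * (N * G2 * t) ^+ 2) <= C * (L * t ^+ 2 / 2).
  rewrite (_ : N * _ = 2 * N * (N * G2) ^+ 2 * (L * t ^+ 2 / 2)); last by field.
  apply: ler_wpM2r; first by rewrite divr_ge0 // mulr_ge0 // sqr_ge0.
  apply: (@le_trans _ _ (2 * N * (N * G) ^+ 2)).
    by apply: ler_wpM2l => //; rewrite mulr_ge0.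
  by rewrite lerDr mulr_ge0.
by rewrite -/t mulrDr mulrDr lerD.
Qed.
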